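(* Let $(X,\mathcal{A},\mu,T)$ be an ergodic probability preserving system, $(A_l)$ and $(A_l')$ two asymptotically rare sequences in $\mathcal{A}$, and $(\psi_{A_l})$, $(\psi'_{A_l'})$ two sequences of $\mathfrak{F}$-valued local observables for the sets $A_l$ and $A_l'$, respectively. Assume that $\mu(A_l\triangle A_l')=o(\mu(A_l))$ as $l\to\infty$, and that $d_{\mathfrak{F}}(\psi_{A_l},\psi'_{A_l'})\to0$ in $\mu_{A_l\cap A_l'}$-probability as $l\to\infty$. Then for any random sequence $\widetilde\Psi$ in $\mathfrak{F}$, $$\widetilde\Psi_{A_l}\overset{\mu_{A_l}}{\Longrightarrow}\widetilde\Psi\quad\text{iff}\quad\widetilde\Psi'_{A_l'}\overset{\mu_{A_l'}}{\Longrightarrow}\widetilde\Psi,$$ where $\widetilde\Psi_{A_l}$ and $\widetilde\Psi'_{A_l'}$ are the local processes given by $\psi_{A_l}$ and $\psi'_{A_l'}$, respectively.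
   Context: $(\mathfrak{F},d_{\mathfrak{F}})$ compact metric space; $T$ ergodic preserving the probability $\mu$. For $A$ with $\mu(A)>0$: $\varphi_A(x):=\inf\{n\ge1:T^nx\in A\}$, $T_Ax:=T^{\varphi_A(x)}x$, $\mu_A:=\mu(A\cap\cdot)/\mu(A)$. Asymptotically rare: $0<\mu(A_l)\to0$. Local observable: measurable $\psi_A:A\to\mathfrak{F}$, with $\widetilde\Psi_A:=(\psi_A,\psi_A\circ T_A,\psi_A\circ T_A^2,\ldots):A\to\mathfrak{F}^{\mathbb{N}_0}$ (product topology). $\overset{\nu}{\Longrightarrow}$: weak convergence of laws under $\nu$. *)

(* Defs.v *)
From HB Require Import structures.
From mathcomp Require Import all_boot all_order all_algebra.
From mathcomp Require Import all_classical all_reals all_analysis.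
Set Implicit Arguments.
Unset Strict Implicit.
Unset Printing Implicit Defensive.
Import Order.TTheory GRing.Theory Num.Theory.
Import numFieldNormedType.Exports.
Local Open Scope classical_set_scope.
Local Open Scope ring_scope.

Definition seqspace (F : topologicalType) := prod_topology (fun _ : nat => F).

Section Dyn.
Context {R : realType} {d : measure_display} {X : measurableType d}.

Definition measure_preserving (mu : {measure set X -> \bar R}) (T : X -> X) :=
  measurable_fun setT T /\
  forall B, measurable B -> mu (T @^-1` B) = mu B.

Definition ergodic (mu : {measure set X -> \bar R}) (T : X -> X) :=
  forall B, measurable B -> T @^-1` B = B -> mu B = 0%E \/ mu B = 1%E.

(** First return time phi_A(x) = inf {n >= 1 : T^n x \in A}
    (convention: 0 if there is no return; this only happens on a null set
    of A by Poincare recurrence, and is irrelevant for the statement). *)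
Definition return_pred (T : X -> X) (A : set X) (x : X) : pred nat :=
  fun n => (0 < n)%N && `[< A (iter n T x) >].

Definition return_time (T : X -> X) (A : set X) (x : X) : nat :=
  match pselect (exists n, return_pred T A x n) with
  | left h => ex_minn h
  | right _ => 0%N
  end.

Definition induced_map (T : X -> X) (A : set X) (x : X) : X :=
  iter (return_time T A x) T x.

Definition local_process {F : topologicalType} (T : X -> X) (A : set X)
  (psi : X -> F) (x : X) : seqspace F :=
  fun n => psi (iter n (induced_map T A) x).

Definition asymp_rare (mu : {measure set X -> \bar R}) (A : nat -> set X) :=
  (forall l, measurable (A l) /\ (0 < mu (A l))%E) /\
  (fun l => mu (A l)) @ \oo --> 0%E.

(** Borel measurability of psi : A -> F (psi is a function on X, only its
    restriction to A matters). *)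
Definition borel_measurable_on {F : topologicalType} (A : set X) (psi : X -> F) :=
  forall U : set F, open U -> measurable (A `&` psi @^-1` U).

Definition cond_integral (mu : {measure set X -> \bar R}) (A : set X)
  (f : X -> R) : \bar R :=
  ((fine (mu A))^-1)%:E * \int[mu]_(x in A) (f x)%:E.

Definition weak_conv {S : topologicalType} (mu : {measure set X -> \bar R})
  (A : nat -> set X) (Z : nat -> X -> S)
  {d' : measure_display} {Om : measurableType d'} (P : probability Om R)
  (Zlim : Om -> S) :=
  forall g : S -> R, continuous g -> (exists M : R, forall z, `|g z| <= M) ->
    (fun l => cond_integral mu (A l) (fun x => g (Z l x))) @ \oo -->
    (\int[P]_w (g (Zlim w))%:E)%E.

End Dyn.

(* Main.v *)
Require Import Defs.
From HB Require Import structures.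
From mathcomp Require Import all_boot all_order all_algebra.
From mathcomp Require Import all_classical all_reals all_analysis.
From mathcomp Require Import ring lra.
Set Implicit Arguments.
Unset Strict Implicit.
Unset Printing Implicit Defensive.
Import Order.TTheory GRing.Theory Num.Theory.
Import numFieldNormedType.Exports.
Local Open Scope classical_set_scope.
Local Open Scope ring_scope.

(** Let B := A ∪ A' and let E be the bad set consisting of A △ A' and of the
    points of A ∩ A' where psi and psi' are at least some small distance apart.
    As long as the orbit under the induced map T_B avoids E, the orbits under
    T_A, T_A' and T_B coincide and the two local processes stay close.  Since
    T_B preserves mu on B, the points of B whose first n + 1 iterates under T_B
    meet E have measure at most (n + 1) mu(E) = o(mu(A)).  A continuous function
    on the compact space of sequences depends, up to epsilon, on finitely many
    coordinates only, so its conditional integrals along the two local processes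
    are asymptotically equal. *)

(** * Return times and the induced map, which does not increase measure *)

Section Induced.
Context {R : realType} {d : measure_display} {X : measurableType d}.
Implicit Types (T : X -> X) (A B E : set X).

(** Positive values are genuine first returns, while 0 is the default for no return; the successor
    form keeps the two cases apart. *)
Lemma return_timeS_iff T B x n : return_time T B x = n.+1 <->
  B (iter n.+1 T x) /\ forall k, (k < n)%N -> ~ B (iter k.+1 T x).
Proof.
rewrite /return_time; case: pselect => [h|h].
- case: ex_minnP => m /andP[m0 /asboolP Bm] mmin; split=> [mn|[Bn ltn]].
    move: Bm; rewrite mn => Bm; split=> // k kn Bk.
    have := mmin k.+1; rewrite /return_pred /= mn ltnS leqNgt kn => Hk.
    by have := Hk (introT (asboolP _) Bk).
  apply/eqP; rewrite eqn_leq mmin /return_pred /= ?asboolT //=.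
  case: m m0 Bm {mmin} => // m _ Bm; rewrite ltnNge; apply/negP => mn.
  by apply: (ltn m).
- split=> // -[Bn _]; exfalso; apply: h; exists n.+1.
  by rewrite /return_pred /= asboolT.
Qed.

Lemma return_time0_iff T B x : return_time T B x = 0%N <->
  forall k, ~ B (iter k.+1 T x).
Proof.
rewrite /return_time; case: pselect => [h|h].
- case: ex_minnP => m /andP[m0 /asboolP Bm] _; split=> [m00|nB].
    by move: m0; rewrite m00.
  by case: m m0 Bm => // m _ /nB.
- split=> // _ k Bk; apply: h; exists k.+1.
  by rewrite /return_pred /= asboolT.
Qed.

(** No exceptional null set appears: by the default return time 0, a point that never returns to [A]
    stays where it is. *)
Lemma induced_map_in T A x : A x -> A (induced_map T A x).
Proof.
move=> Ax; rewrite /induced_map.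
by case E : (return_time T A x) => [//|n]; move: E => /return_timeS_iff[].
Qed.

Lemma iter_induced_map_in T A n x : A x -> A (iter n (induced_map T A) x).
Proof. by move=> Ax; elim: n => //= n; exact: induced_map_in. Qed.

(** An orbit cannot meet [A] before it meets the larger set [B], so a first return to [B] that lands
    in [A] is also the first return to [A]. Without a return to [B], both maps fix [x] by
    default. *)
Lemma induced_map_subset T A B x : A `<=` B -> A (induced_map T B x) ->
  A x -> induced_map T A x = induced_map T B x.
Proof.
move=> AB + Ax; rewrite /induced_map.
case E : (return_time T B x) => [|n].
  move/return_time0_iff : E => nB _.
  by have /return_time0_iff -> : forall k, ~ A (iter k.+1 T x) by move=> k /AB /nB.
move/return_timeS_iff : E => [Bn nB] An.
suff /return_timeS_iff -> : A (iter n.+1 T x) /\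
  forall k, (k < n)%N -> ~ A (iter k.+1 T x) by [].
by split=> // k /nB h /AB.
Qed.

Lemma measurable_fun_iter T n :
  measurable_fun setT T -> measurable_fun setT (iter n T).
Proof.
move=> mT; elim: n => [|n IH]; first exact: measurable_id.
by apply: (measurableT_comp mT IH).
Qed.

Lemma measurable_preimage_iter T B n : measurable_fun setT T -> measurable B ->
  measurable (iter n T @^-1` B).
Proof.
by move=> mT mB; rewrite -[X in measurable X]setTI; exact: measurable_fun_iter.
Qed.

Lemma measurable_return_time T B n : measurable_fun setT T -> measurable B ->
  measurable [set x | return_time T B x = n].
Proof.
move=> mT mB; case: n => [|n].
  rewrite (_ : [set _ | _] = \bigcap_k ~` (iter k.+1 T @^-1` B)); last first.
    apply/seteqP; split=> x /=.
      by move=> /return_time0_iff h k _; exact: h.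
    by move=> h; apply/return_time0_iff => k; exact: h.
  apply: bigcapT_measurable => k.
  by apply: measurableC; exact: measurable_preimage_iter.
rewrite (_ : [set _ | _] = (iter n.+1 T @^-1` B) `&`
   \bigcap_k (if (k < n)%N then ~` (iter k.+1 T @^-1` B) else setT)); last first.
  apply/seteqP; split=> x /=.
    move=> /return_timeS_iff[Bn h]; split=> // k _.
    by case: ifPn => // /h.
  move=> [Bn h]; apply/return_timeS_iff; split=> // k kn.
  by have := h k I; rewrite kn.
apply: measurableI; first exact: measurable_preimage_iter.
apply: bigcapT_measurable => k; case: ifPn => // _.
by apply: measurableC; exact: measurable_preimage_iter.
Qed.

Lemma measurable_induced_map T B : measurable_fun setT T -> measurable B ->
  measurable_fun setT (induced_map T B).
Proof.
move=> mT mB _ E mE; rewrite setTI.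
rewrite (_ : _ @^-1` _ = \bigcup_n ([set x | return_time T B x = n] `&`
  (iter n T @^-1` E))); last first.
  apply/seteqP; split=> x /=; first by move=> Ex; exists (return_time T B x).
  by move=> [n _ /= [rn En]]; rewrite /induced_map rn.
apply: bigcupT_measurable => n; apply: measurableI.
  exact: measurable_return_time.
exact: measurable_preimage_iter.
Qed.

Variables (mu : probability X R) (T : X -> X).
Hypothesis hT : measure_preserving mu T.

Let mT : measurable_fun setT T := hT.1.

Let pT C : measurable C -> mu (T @^-1` C) = mu C.
Proof. exact: hT.2. Qed.

(* With B* the set of points whose orbit meets B, T^-1 B* is contained in B*
   and has the same measure, and a point of B that never returns to B lies in
   B* but not in T^-1 B*. *)
Lemma never_return_null B : measurable B ->
  mu (B `&` [set x | return_time T B x = 0%N]) = 0%E.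
Proof.
move=> mB.
pose Bs := \bigcup_k (iter k T @^-1` B).
have mBs : measurable Bs.
  by apply: bigcupT_measurable => k; exact: measurable_preimage_iter.
have mTBs : measurable (T @^-1` Bs) by rewrite -[X in measurable X]setTI; exact: mT.
have TBs : T @^-1` Bs `<=` Bs.
  by move=> x [k _ /= Bk]; exists k.+1 => //=; rewrite -iterS iterSr.
have null : mu (Bs `\` T @^-1` Bs) = 0%E.
  have -> : mu (Bs `\` T @^-1` Bs) = (mu Bs - mu (Bs `&` T @^-1` Bs))%E.
    by apply: measureD; rewrite // ltey_eq fin_num_measure.
  by rewrite setIidr// pT// subee// fin_num_measure.
apply: (subset_measure0 _ _ _ null).
- by apply: measurableI => //; exact: measurable_return_time.
- exact: measurableD.
- move=> x [Bx /return_time0_iff nB]; split; first by exists 0%N.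
  by move=> [k _ /=]; rewrite -iterSr => /nB.
Qed.

(* Let V n be the set of points entering B for the first time at time n + 1,
   and then landing in E.  Then T^-1 E = V 0 and T^-1 (V n \ B) = V (n + 1),
   so the masses of the V n within B add up to at most that of E. *)
Lemma induced_map_measure_le B E : measurable B -> measurable E -> E `<=` B ->
  (mu (B `&` induced_map T B @^-1` E) <= mu E)%E.
Proof.
move=> mB mE EB.
pose V n := [set x | return_time T B x = n.+1] `&` iter n.+1 T @^-1` E.
have mV n : measurable (V n).
  by apply: measurableI; [exact: measurable_return_time|exact: measurable_preimage_iter].
have V0 : T @^-1` E = V 0%N.
  apply/seteqP; split=> x /=; last by move=> [].
  by move=> Ex; split=> //; apply/return_timeS_iff; split=> //; exact: EB.
have VS n : T @^-1` (V n `\` B) = V n.+1.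
  apply/seteqP; split=> x; rewrite /V /=.
    rewrite -!iterSr => -[[/return_timeS_iff[Bn nB] En] nBx]; split; last exact: En.
    apply/return_timeS_iff; split; first by rewrite iterSr.
    by move=> [|k] kn //; rewrite iterSr; exact: nB.
  move=> [/return_timeS_iff[Bn nB] En].
  split; last exact: (nB 0%N).
  split; last by rewrite -!iterSr.
  apply/return_timeS_iff; rewrite -iterSr; split=> // k kn.
  by rewrite -iterSr; exact: (nB k.+1).
have sumV n : (mu (V n) + \sum_(0 <= k < n) mu (B `&` V k) = mu E)%E.
  elim: n => [|n IH]; first by rewrite big_geq// adde0 -V0 pT.
  rewrite -VS pT; last exact: measurableD.
  have VD : mu (V n) = (mu (V n `\` B) + mu (B `&` V n))%E.
    by rewrite (setIC B); exact: measureDI.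
  by rewrite big_nat_recr//= -IH VD -addeA; congr (_ + _)%E; rewrite addeC.
have leV : (mu (B `&` \bigcup_k V k) <= mu E)%E.
  have mBV k : measurable (B `&` V k) by exact: measurableI.
  apply: (@le_trans _ _ (\sum_(0 <= k <oo) mu (B `&` V k))%E).
    apply: measure_sigma_subadditive => //; last by rewrite setI_bigcupr.
    by apply: measurableI => //; exact: bigcupT_measurable.
  apply: lime_le; first by apply: is_cvg_nneseries => k _ _; exact: measure_ge0.
  by apply: nearW => n; rewrite -(sumV n) leeDr.
have mW : measurable (B `&` [set x | return_time T B x = 0%N]).
  by apply: measurableI => //; exact: measurable_return_time.
have mU : measurable (B `&` \bigcup_k V k).
  by apply: measurableI => //; exact: bigcupT_measurable.
apply: (le_trans _ leV).
(* Points of [B] that never return are fixed by [induced_map] and may thus lie in the preimage of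
   [E]; they are absorbed as a null set. *)
rewrite -[leRHS](measureU0 mU mW)//; last exact: never_return_null.
apply: le_measure; rewrite ?inE.
- apply: measurableI => //; rewrite -[X in measurable X]setTI.
  exact: measurable_induced_map.
- exact: measurableU.
- move=> x [Bx]; rewrite /induced_map /=.
  case rx: (return_time T B x) => [|n] Ex; first by right.
  by left; split=> //; exists n.
Qed.

Lemma iter_induced_map_measure_le B E n :
  measurable B -> measurable E -> E `<=` B ->
  (mu (B `&` iter n (induced_map T B) @^-1` E) <= mu E)%E.
Proof.
move=> mB mE EB.
elim: n => [|n IH]; first by rewrite setIidr.
have mS := measurable_induced_map mT mB.
apply: le_trans IH.
(* Since [induced_map T B] keeps [B] inside itself, the inner preimage may be cut down to a subset
   of [B], as the one-step bound requires. *)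
rewrite (_ : B `&` _ = B `&` induced_map T B @^-1`
  (B `&` iter n (induced_map T B) @^-1` E)).
  apply: induced_map_measure_le => //; apply: measurableI => //.
  exact: measurable_preimage_iter.
apply/seteqP; split=> x /= [Bx]; rewrite -iterS iterSr => h; split=> //.
  by split=> //; exact: induced_map_in.
by case: h.
Qed.

End Induced.

(** Serves the triangle inequality: two steps of the radius with index 2m+1 fit into the radius with
    index m. *)
Lemma natSinv_double (R : realType) m :
  m.*2.+2%:R^-1 + m.*2.+2%:R^-1 = m.+1%:R^-1 :> R.
Proof.
have -> : m.*2.+2%:R = m.+1%:R * 2 :> R.
  by rewrite -natrM; congr (_%:R); rewrite -muln2 mulSn addSn add1n.
by rewrite invfM -mulrDr -[2^-1]mul1r -splitr mulr1.
Qed.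

(** * Cylinder neighbourhoods, uniform continuity and dense sequences *)

Section SequenceSpace.
Context {R : realType} {F : metricType R}.
Implicit Types (z w : seqspace F).

(** A single index governs both the number of coordinates and the radius, so the cylinders at a
    point form a decreasing countable neighbourhood base. *)
Definition cylinder (n : nat) (z : seqspace F) : set (seqspace F) :=
  [set w | forall i, (i < n)%N -> mdist (z i) (w i) < n.+1%:R^-1].

Lemma cylinder_le m n z : (m <= n)%N -> cylinder n z `<=` cylinder m z.
Proof.
move=> mn w zw i im; apply: lt_le_trans (zw i (leq_trans im mn)) _.
by rewrite lef_pV2 ?posrE// ler_nat.
Qed.

Lemma cylinder_nbhs n z : nbhs z (cylinder n z).
Proof.
(* The radius is decoupled from the number of coordinates, so that it stays fixed during the
   induction. *)
suff near_lt m e : 0 < e ->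
    nbhs z [set w : seqspace F | forall i, (i < m)%N -> mdist (z i) (w i) < e].
  exact: near_lt.
move=> e0; elim: m => [|m IH]; first exact: (filterS _ filterT).
have zm : nbhs z [set w : seqspace F | mdist (z m) (w m) < e].
  have := @proj_continuous _ (fun _ : nat => F) m z (ball (z m) e)
    (nbhsx_ballx _ _ e0).
  by rewrite ballEmdist.
apply: filterS (filterI IH zm) => w [lem em] i.
by rewrite ltnS leq_eqVlt => /predU1P[->//|]; exact: lem.
Qed.

(** The filter generated by the cylinders at [z] converges in every coordinate, hence in the product
    topology, so it contains all neighbourhoods of [z]. *)
Lemma nbhs_cylinder z (U : set (seqspace F)) :
  nbhs z U -> exists n, cylinder n z `<=` U.
Proof.
pose G := filter_from setT (cylinder^~ z).
have FG : Filter G.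
  apply: filter_fromT_filter; first by exists 0%N.
  move=> m n; exists (maxn m n) => w h.
  by split; apply: cylinder_le h; rewrite ?leq_maxl ?leq_maxr.
have Gz : G --> z.
  apply/cvg_sup => i A [_ [[B Bop <-] Bz sBA]].
  have : nbhs (z i) B by apply: open_nbhs_nbhs.
  move=> /nbhs_ballP[e /= e0 eB].
  have [k] := ltr_add_invr e0; rewrite add0r => ke.
  (* The index must exceed [i] to control coordinate [i], and be at least [k] to make the radius
     smaller than [e]. *)
  exists (maxn i.+1 k) => // w zw; apply/sBA/eB; rewrite ballEmdist /=.
  apply: lt_trans (lt_le_trans (zw i _) _) ke; first by rewrite leq_maxl.
  by rewrite lef_pV2 ?posrE// ler_nat ltnS leq_maxr.
by move=> /Gz[n _ nU]; exists n.
Qed.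

Hypothesis hF : compact [set: F].

(** The sequence space is compact by Tychonoff, and the near-covering form of compactness turns an
    index that works near each point into one that works everywhere. *)
Lemma continuous_seqspace_unif (g : seqspace F -> R) (e : R) :
  continuous g -> 0 < e ->
  exists n, forall z w, cylinder n z w -> `|g z - g w| < e.
Proof.
move=> cg e0.
have cS : compact [set: seqspace F].
  have := @tychonoff nat (fun=> F) (fun=> setT) (fun=> hF).
  by rewrite (_ : [set f | _] = setT)//; apply/seteqP; split.
move/compact_near_coveringP : cS.
move=> /(_ nat \oo (fun n z => forall w, cylinder n z w -> `|g z - g w| < e)).
case.
  move=> z _.
  have e20 : 0 < e / 2 by rewrite divr_gt0.
  have /nbhs_cylinder[m zm] : nbhs z (g @^-1` ball (g z) (e / 2)).
    by apply: cg; exact: nbhsx_ballx.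
  have gm w : cylinder m z w -> `|g z - g w| < e / 2 by move=> /zm.
  (* Cylinder [k] has half the radius of cylinder [m]: if [v] is [k]-close to [z] and [w] is
     [k]-close to [v], both lie in cylinder [m] at [z], where [g] is within e/2 of [g z]. *)
  pose k := (m.*2).+1.
  exists (cylinder k z, [set n | (k <= n)%N]).
    by split; [exact: cylinder_nbhs|exists k].
  have mk : (m <= k)%N by rewrite /k -addnn; apply: leqW; rewrite leq_addr.
  have k2 := natSinv_double R m.
  move=> [v n] [/= zv kn] w vw.
  rewrite -(subrKA (g z)) [e]splitr (le_lt_trans (ler_normD _ _))// ltrD//.
    by rewrite distrC; apply: gm; exact: cylinder_le zv.
  apply: gm => i im.
  apply: le_lt_trans (metric_triangle _ (v i) _) _.
  rewrite -k2 ltrD//; first by apply: zv; exact: leq_trans im mk.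
  by apply: (cylinder_le kn vw); exact: leq_trans im mk.
by move=> n _ /(_ n (leqnn n)) h; exists n => z w; apply: h.
Qed.

(** Compactness gives a finite net at each scale 1/(n+1); the countably many nets are listed as one
    sequence by coding pairs (scale, position). *)
Lemma compact_dense_sequence (y0 : F) :
  exists D : nat -> F, forall y e, 0 < e -> exists n, mdist y (D n) < e.
Proof.
have net n : exists s : seq F,
    forall y, exists k, mdist y (nth y0 s k) < n.+1%:R^-1.
  (* Along this filter a property holds eventually when it holds for all lists containing some fixed
     finite list; near-covering then produces a list serving every [y]. *)
  pose G := filter_from [set: seq F] 
    (fun s0 => [set s : seq F | {subset s0 <= s}]).
  have FG : Filter G.
    apply: filter_fromT_filter; first by exists [::].
    move=> s t; exists (s ++ t) => u /= stu.
    by split=> p pu; apply: stu; rewrite mem_cat pu ?orbT.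
  move/compact_near_coveringP : (hF).
  move=> /(_ _ G (fun s y => exists2 p, p \in s & mdist y p < n.+1%:R^-1)).
  case.
    move=> y _; exists (ball y n.+1%:R^-1, [set s : seq F | y \in s]).
      split; first exact: nbhsx_ballx.
      by exists [:: y] => // s; apply; rewrite inE.
    move=> [v s] [/= yv ys]; exists y => //.
    by rewrite metric_sym; move: yv; rewrite ballEmdist.
  move=> s _ /(_ s (fun _ h => h)) hs; exists s => y.
  have [p ps yp] := hs y I; exists (index p s).
  by rewrite nth_index.
have [s hs] := choice net.
exists (fun m => if unpickle m is Some (n, k) then nth y0 (s n) k else y0).
move=> y e e0; have [n] := ltr_add_invr e0; rewrite add0r => ne.
have [k yk] := hs n y; exists (pickle (n, k)); rewrite pickleK.
exact: lt_trans yk ne.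
Qed.

End SequenceSpace.

(** * Measurability of local processes and of distances between observables *)

Section Measurability.
Context {R : realType} {d : measure_display} {X : measurableType d}.
Context {F : metricType R}.
Variable D : nat -> F.
Hypothesis denseD : forall y e, 0 < e -> exists n, mdist y (D n) < e.

Lemma measurable_mdist_lt (A : set X) (psi : X -> F) (y : F) (e : R) :
  borel_measurable_on A psi -> measurable (A `&` [set x | mdist y (psi x) < e]).
Proof.
move=> mpsi; rewrite (_ : [set _ | _] = psi @^-1` [set z | mdist y z < e])//.
apply: mpsi; rewrite openE => z /= yz; rewrite /interior.
apply/nbhs_ballP; exists (e - mdist y z); first by rewrite /= subr_gt0.
move=> w; rewrite ballEmdist /= ltrBrDl; apply: le_lt_trans.
exact: metric_triangle.
Qed.

(** The product topology has a countable base of cylinders centred at points of the dense sequence,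
    so [U] is a countable union of sets whose preimages involve finitely many coordinates. *)
Lemma measurable_seqspace_preimage (A : set X) (Z : X -> seqspace F)
  (U : set (seqspace F)) :
  measurable A -> (forall i, borel_measurable_on A (fun x => Z x i)) -> open U ->
  measurable (A `&` Z @^-1` U).
Proof.
move=> mA mZ oU.
(* The list [t] codes a basic cylinder: its entries index the centres, and its length fixes both the
   number of coordinates and the radius. *)
pose C (t : seq nat) :=
  [set w : seqspace F | forall i, (i < size t)%N ->
     mdist (D (nth 0%N t i)) (w i) < (size t).+1%:R^-1].
rewrite (_ : A `&` _ = \bigcup_t (if `[< C t `<=` U >] then A `&` Z @^-1` C t
  else set0)); last first.
  apply/seteqP; split=> x; last first.
    by move=> [t _]; case: asboolP => // CU [Ax /CU].
  move=> [Ax /= Ux].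
  have /nbhs_cylinder[m zU] : nbhs (Z x) U by apply: open_nbhs_nbhs.
  pose k := (m.*2).+1.
  have mk : (m <= k)%N by rewrite /k -addnn; apply: leqW; rewrite leq_addr.
  have k2 := natSinv_double R m.
  have [j hj] := choice (fun i => denseD (Z x i) (ltac:(by []) : 0 < k.+1%:R^-1 :> R)).
  have st : size (mkseq j k) = k by rewrite size_mkseq.
  exists (mkseq j k) => //; case: asboolP => [_|nCU].
    split=> //= i; rewrite st => ik.
    by rewrite nth_mkseq// metric_sym.
  exfalso; apply: nCU => w wC; apply: zU => i im.
  have ik := leq_trans im mk.
  apply: le_lt_trans (metric_triangle _ (D (j i)) _) _.
  by rewrite -k2 ltrD//; have := wC i; rewrite st nth_mkseq//; exact.
apply: countable_bigcupT_measurable => // t.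
case: ifPn => // _.
have -> : A `&` Z @^-1` C t = \bigcap_i (A `&` (if (i < size t)%N then
    [set x | mdist (D (nth 0%N t i)) (Z x i) < (size t).+1%:R^-1] else setT)).
  apply/seteqP; split=> x /=.
    by move=> [Ax Cx] i _; split=> //; case: ifPn => // /Cx.
  move=> h; split; first by have [] := h 0%N I.
  by move=> i it; have [_] := h i I; rewrite it.
apply: bigcapT_measurable => i; case: ifPn => [_|_]; last by rewrite setIT.
exact: measurable_mdist_lt.
Qed.

Lemma measurable_fun_seqspace (A : set X) (Z : X -> seqspace F)
  (g : seqspace F -> R) :
  measurable A -> (forall i, borel_measurable_on A (fun x => Z x i)) ->
  continuous g -> measurable_fun A (g \o Z).
Proof.
move=> mA mZ cg _; apply: (measurability _ (measurable_realfun.RGenOInfty.measurableE R)) => //.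
move=> /= _ [_ [x ->] <-].
rewrite comp_preimage; apply: measurable_seqspace_preimage => //.
by move/continuousP : cg; apply; exact: interval_open.
Qed.

(** The condition is separated into one on [psi] and one on [psi'] through a point of the dense
    sequence, which reduces it to preimages of balls under each map. *)
Lemma measurable_mdist_gt (A : set X) (psi psi' : X -> F) (e : R) :
  measurable A ->
  borel_measurable_on A psi -> borel_measurable_on A psi' ->
  measurable (A `&` [set x | e < mdist (psi x) (psi' x)]).
Proof.
move=> mA mpsi mpsi'.
rewrite (_ : _ `&` _ = \bigcup_m \bigcup_k
  ((A `&` [set x | mdist (D m) (psi x) < k.+1%:R^-1]) `\`
   (A `&` [set x | mdist (D m) (psi' x) < e + k.+1%:R^-1]))); last first.
  apply/seteqP; split=> x /=.
    move=> [Ax ex].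
    (* Half of the excess over [e]: one half covers the distance from [psi x] to the centre, the
       other the margin in the second condition. *)
    have e0 : 0 < (mdist (psi x) (psi' x) - e) / 2 by rewrite divr_gt0// subr_gt0.
    have [k] := ltr_add_invr e0; rewrite add0r => ke.
    have [m xm] := denseD (psi x) (ltac:(by []) : 0 < k.+1%:R^-1 :> R).
    exists m => //; exists k => //=; split; first by rewrite metric_sym.
    move=> [_ h]; move: ke; rewrite ltr_pdivlMr// ltrBrDl; apply/negP.
    rewrite -leNgt mulr_natr mulr2n addrA addrC.
    apply: le_trans (metric_triangle _ (D m) _) _.
    by rewrite lerD// ltW.
  move=> [m _ [k _ /= [[Ax xm] h]]]; split=> //.
  rewrite ltNge; apply/negP => h2; apply: h; split=> //.
  apply: le_lt_trans (metric_triangle _ (psi x) _) _.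
  by rewrite addrC ler_ltD.
apply: bigcupT_measurable => m; apply: bigcupT_measurable => k.
by apply: measurableD; exact: measurable_mdist_lt.
Qed.

Lemma borel_measurable_on_subset (A B : set X) (psi : X -> F) :
  measurable B -> B `<=` A -> borel_measurable_on A psi ->
  borel_measurable_on B psi.
Proof.
move=> mB BA mpsi U oU.
by rewrite -(setIidl BA) -setIA; apply: measurableI => //; exact: mpsi.
Qed.

(** Orbits under the induced map stay in [A], the set on which [psi] is known to be measurable. *)
Lemma borel_measurable_local_process (T : X -> X) (A : set X) (psi : X -> F) i :
  measurable_fun setT T -> measurable A -> borel_measurable_on A psi ->
  borel_measurable_on A (fun x => local_process T A psi x i).
Proof.
move=> mT mA mpsi U oU.
rewrite (_ : _ `&` _ = A `&` iter i (induced_map T A) @^-1` (A `&` psi @^-1` U)).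
  apply: measurableI => //; apply: measurable_preimage_iter; last exact: mpsi.
  exact: measurable_induced_map.
apply/seteqP; split=> x /= [Ax h]; split=> //.
  by split=> //; exact: iter_induced_map_in.
by case: h.
Qed.

End Measurability.

(** * Comparison of conditional integrals over two sets *)

Section Comparison.
Context {R : realType} {d : measure_display} {X : measurableType d}.
Variable mu : probability X R.

Lemma fine_measure_le (E F : set X) : measurable E -> measurable F ->
  E `<=` F -> fine (mu E) <= fine (mu F).
Proof.
move=> mE mF EF; apply: fine_le; rewrite ?fin_num_measure//.
by apply: le_measure; rewrite ?inE.
Qed.

Lemma fine_measureU_le (E F : set X) : measurable E -> measurable F ->
  fine (mu (E `|` F)) <= fine (mu E) + fine (mu F).
Proof.
move=> mE mF; rewrite -fineD ?fin_num_measure//; apply: fine_le.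
- by rewrite fin_num_measure//; exact: measurableU.
- by rewrite fin_numD !fin_num_measure.
- exact: measureU2.
Qed.

Lemma bounded_integrable (E : set X) (f : X -> R) (M : R) :
  measurable E -> measurable_fun E f -> (forall x, `|f x| <= M) ->
  mu.-integrable E (EFin \o f).
Proof.
move=> mE mf fM; apply: measurable_bounded_integrable => //.
  by rewrite ltey_eq fin_num_measure.
exists M; split; first exact: num_real.
by move=> r Mr x _ /=; apply: le_trans (fM x) (ltW Mr).
Qed.

Lemma normr_Rintegral_le (E : set X) (f : X -> R) (M : R) :
  measurable E -> mu.-integrable E (EFin \o f) ->
  (forall x, E x -> `|f x| <= M) ->
  `|\int[mu]_(x in E) f x| <= M * fine (mu E).
Proof.
move=> mE If fM; apply: le_trans (le_normr_Rintegral mE If) _.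
rewrite -Rintegral_cst//; apply: le_Rintegral => //.
- exact: integrable_norm.
- exact: finite_measure_integrable_cst.
Qed.

Lemma fine_cond_integral (E : set X) (f : X -> R) :
  measurable E -> mu.-integrable E (EFin \o f) ->
  fine (cond_integral mu E f) = (fine (mu E))^-1 * \int[mu]_(x in E) f x.
Proof.
by move=> mE If; rewrite /cond_integral fineM// integrable_fin_num.
Qed.

Lemma cond_integral_fin_num (E : set X) (f : X -> R) (M : R) :
  measurable E -> measurable_fun E f -> (forall x, `|f x| <= M) ->
  cond_integral mu E f \is a fin_num.
Proof.
move=> mE mf fM; rewrite /cond_integral fin_numM//.
by apply: integrable_fin_num => //; exact: bounded_integrable.
Qed.

(** On [G] the integrands differ by at most [e]. The factor 2 collects two errors of the same size:
    the integrals off [G], and the change of normalisation, since the masses of [A] and [A'] differ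
    only off [G]. *)
Lemma cond_integral_close (A A' G : set X) (f f' : X -> R) (M e : R) :
  measurable A -> measurable A' -> measurable G -> G `<=` A -> G `<=` A' ->
  measurable_fun A f -> measurable_fun A' f' -> 0 <= M -> 0 <= e ->
  (forall x, `|f x| <= M) -> (forall x, `|f' x| <= M) ->
  (forall x, G x -> `|f x - f' x| <= e) ->
  (0 < mu A)%E -> (0 < mu A')%E ->
  `|fine (cond_integral mu A f) - fine (cond_integral mu A' f')| <=
  e + 2 * M * ((fine (mu (A `\` G)) + fine (mu (A' `\` G))) / fine (mu A)).
Proof.
move=> mA mA' mG GA GA' mf mf' M0 e0 fM f'M ff' A0 A'0.
have mAG : measurable (A `\` G) by exact: measurableD.
have mA'G : measurable (A' `\` G) by exact: measurableD.
have If : mu.-integrable A (EFin \o f) by exact: bounded_integrable fM.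
have If' : mu.-integrable A' (EFin \o f') by exact: bounded_integrable f'M.
have split_int E h : measurable E -> G `<=` E -> mu.-integrable E (EFin \o h) ->
    \int[mu]_(x in E) h x = \int[mu]_(x in G) h x + \int[mu]_(x in E `\` G) h x.
  move=> mE GE Ih; rewrite -{1}(setDUK GE) Rintegral_setU//.
  - exact: measurableD.
  - by rewrite setDUK.
  - by rewrite disj_set2E setDIK.
have split_mu E : measurable E -> G `<=` E ->
    fine (mu E) = fine (mu G) + fine (mu (E `\` G)).
  move=> mE GE; rewrite -fineD ?fin_num_measure//; last exact: measurableD.
  congr fine; rewrite -[in LHS](setDUK GE); apply: measureU => //.
    exact: measurableD.
  by rewrite setDIK.
have IAG : mu.-integrable (A `\` G) (EFin \o f).
  exact: (integrableS mA _ _ If).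
have IA'G : mu.-integrable (A' `\` G) (EFin \o f').
  exact: (integrableS mA' _ _ If').
have IG : mu.-integrable G (EFin \o f) by exact: (integrableS mA _ _ If).
have IG' : mu.-integrable G (EFin \o f') by exact: (integrableS mA' _ _ If').
rewrite !fine_cond_integral//.
have bp := normr_Rintegral_le mAG IAG (fun x _ => fM x).
have bq := normr_Rintegral_le mA'G IA'G (fun x _ => f'M x).
have bI' := normr_Rintegral_le mA' If' (fun x _ => f'M x).
have bG : `|\int[mu]_(x in G) f x - \int[mu]_(x in G) f' x| <= e * fine (mu G).
  rewrite -RintegralB//; apply: normr_Rintegral_le => //.
  by have := integrableB mG IG IG'; apply: eq_integrable.
have EI := split_int A f mA GA If; have EI' := split_int A' f' mA' GA' If'.
have Ea := split_mu A mA GA; have Ea' := split_mu A' mA' GA'.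
have a0 : 0 < fine (mu A) by rewrite fine_gt0// A0 ltey_eq fin_num_measure.
have a'0 : 0 < fine (mu A') by rewrite fine_gt0// A'0 ltey_eq fin_num_measure.
have p0 : 0 <= fine (mu (A `\` G)) by exact: fine_ge0.
have q0 : 0 <= fine (mu (A' `\` G)) by exact: fine_ge0.
have g0 : 0 <= fine (mu G) by exact: fine_ge0.
move: EI EI' Ea Ea' bp bq bI' bG a0 a'0 p0 q0 g0.
move: (\int[mu]_(x in A) f x) (\int[mu]_(x in A') f' x)
  (\int[mu]_(x in G) f x) (\int[mu]_(x in G) f' x)
  (\int[mu]_(x in A `\` G) f x) (\int[mu]_(x in A' `\` G) f' x)
  (fine (mu A)) (fine (mu A')) (fine (mu G)) (fine (mu (A `\` G)))
  (fine (mu (A' `\` G))).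
move=> I I' J J' K K' a a' g p q EI EI' Ea Ea' bp bq bI' bG a0 a'0 p0 q0 g0.
have an0 : a != 0 by rewrite gt_eqF.
have a'n0 : a' != 0 by rewrite gt_eqF.
(* Everything is normalised by [a]; the last term is the cost of this, where [I' / a'] is an average
   of [f'] and hence bounded by [M]. *)
have -> : a^-1 * I - a'^-1 * I' =
    ((J - J') + (K - K') + I' / a' * (a' - a)) / a.
  rewrite [in RHS](_ : J - J' + (K - K') = I - I'); last by rewrite EI EI'; ring.
  by field; rewrite an0.
rewrite normrM (gtr0_norm (_ : 0 < a^-1)) ?invr_gt0// ler_pdivrMr// mulrDl.
have -> : 2 * M * ((p + q) / a) * a = 2 * M * (p + q) by field.
have b1 : `|I' / a' * (a' - a)| <= M * (p + q).
  rewrite normrM ler_pM//.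
    by rewrite normrM (gtr0_norm (_ : 0 < a'^-1)) ?invr_gt0// ler_pdivrMr.
  have -> : a' - a = q - p by rewrite Ea Ea'; ring.
  by apply: le_trans (ler_normB _ _) _; rewrite !ger0_norm// addrC.
have b2 : `|K - K'| <= M * (p + q).
  by apply: le_trans (ler_normB _ _) _; rewrite mulrDr lerD.
have b3 : `|J - J'| <= e * a.
  by apply: le_trans bG _; rewrite ler_wpM2l// Ea lerDl.
apply: le_trans (ler_normD _ _) _; apply: le_trans (lerD (ler_normD _ _) b1) _.
have : `|J - J'| + `|K - K'| <= e * a + M * (p + q) by rewrite lerD.
lra.
Qed.

(** * Orbits of the induced map and their visits to a bad set *)

Variable T : X -> X.
Hypothesis hT : measure_preserving mu T.

Lemma iter_induced_map_eq (A B : set X) (x : X) (n : nat) : A `<=` B ->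
  (forall i, (i <= n)%N -> A (iter i (induced_map T B) x)) ->
  iter n (induced_map T A) x = iter n (induced_map T B) x.
Proof.
move=> AB; elim: n => //= n IH An.
rewrite IH; last by move=> i ilen; apply: An; exact: leqW.
by apply: induced_map_subset => //; [exact: (An n.+1)|exact: (An n)].
Qed.

Definition visits (B E : set X) (n : nat) : set X :=
  [set x | B x /\ exists2 i, (i < n)%N & E (iter i (induced_map T B) x)].

Lemma visits_recr B E n : visits B E n.+1 =
  visits B E n `|` (B `&` iter n (induced_map T B) @^-1` E).
Proof.
apply/seteqP; split=> x.
  move=> [Bx [i]]; rewrite ltnS leq_eqVlt => /predU1P[->|ilen] Ei; first by right.
  by left; split=> //; exists i.
case=> [[Bx [i ilen Ei]]|[Bx En]]; split=> //; last by exists n.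
by exists i => //; exact: ltnW.
Qed.

Lemma measurable_visits B E n : measurable B -> measurable E ->
  measurable (visits B E n).
Proof.
move=> mB mE; elim: n => [|n IH].
  by rewrite (_ : visits _ _ _ = set0)//; apply/seteqP; split=> // x [_ []].
rewrite visits_recr; apply: measurableU => //; apply: measurableI => //.
apply: measurable_preimage_iter => //.
by apply: measurable_induced_map => //; exact: hT.1.
Qed.

(** Union bound: each of the [n] times costs at most the mass of [E], as the induced map does not
    increase measure. *)
Lemma visits_measure_le B E n : measurable B -> measurable E -> E `<=` B ->
  fine (mu (visits B E n)) <= n%:R * fine (mu E).
Proof.
move=> mB mE EB; elim: n => [|n IH].
  rewrite (_ : visits _ _ _ = set0); first by rewrite measure0 mul0r.
  by apply/seteqP; split=> // x [_ []].
have mI : measurable (B `&` iter n (induced_map T B) @^-1` E).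
  apply: measurableI => //; apply: measurable_preimage_iter => //.
  by apply: measurable_induced_map => //; exact: hT.1.
rewrite visits_recr -natr1 mulrDl mul1r.
apply: le_trans (fine_measureU_le _ mI) _; first exact: measurable_visits.
apply: lerD => //; apply: fine_le; rewrite ?fin_num_measure//.
exact: iter_induced_map_measure_le.
Qed.

End Comparison.

(** * Asymptotic comparison of the two local processes *)

Lemma bad_set_negligible (R : realType) (d : measure_display)
  (X : measurableType d) (mu : probability X R) (A A' Q : nat -> set X) :
  (forall l, measurable (A l) /\ (0 < mu (A l))%E) ->
  (forall l, measurable (A' l)) -> (forall l, measurable (Q l)) ->
  (forall l, Q l `<=` A l `&` A' l) ->
  (fun l => fine (mu ((A l `\` A' l) `|` (A' l `\` A l))) / fine (mu (A l)))
    @ \oo --> 0 ->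
  (fun l => fine (mu (Q l)) / fine (mu (A l `&` A' l))) @ \oo --> 0 ->
  (fun l => fine (mu (((A l `\` A' l) `|` (A' l `\` A l)) `|` Q l))
    / fine (mu (A l))) @ \oo --> 0.
Proof.
move=> hA mA' mQ QA hsym hQ.
apply: (@squeeze_cvgr _ _ _ _ (cst 0) (fun l =>
  fine (mu ((A l `\` A' l) `|` (A' l `\` A l))) / fine (mu (A l)) +
  fine (mu (Q l)) / fine (mu (A l `&` A' l)))).
- apply: nearW => l; have [mA A0] := hA l.
  have a0 : 0 < fine (mu (A l)) by rewrite fine_gt0// A0 ltey_eq fin_num_measure.
  have mS : measurable ((A l `\` A' l) `|` (A' l `\` A l)).
    by apply: measurableU; exact: measurableD.
  have mI : measurable (A l `&` A' l) by exact: measurableI.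
  rewrite divr_ge0 ?fine_ge0//=.
  apply: (@le_trans _ _ ((fine (mu ((A l `\` A' l) `|` (A' l `\` A l))) +
      fine (mu (Q l))) / fine (mu (A l)))).
    by rewrite ler_wpM2r ?invr_ge0 ?fine_ge0// fine_measureU_le.
  (* What remains is the change of normalisation for [Q l]: dividing by the larger mass of [A l]
     only decreases the quotient. *)
  rewrite mulrDl lerD2l.
  have q0 : 0 <= fine (mu (Q l)) by exact: fine_ge0.
  have qI := fine_measure_le mu (mQ l) mI (@QA l).
  have IA : fine (mu (A l `&` A' l)) <= fine (mu (A l)) by exact: fine_measure_le.
  (* Q l is null when the quotient is the junk value x / 0 = 0 *)
  have [I0|I0] := eqVneq (fine (mu (A l `&` A' l))) 0.
    have -> : fine (mu (Q l)) = 0 by apply/eqP; rewrite eq_le q0 andbT -I0.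
    by rewrite !mul0r.
  rewrite ler_wpM2l// lef_pV2// posrE lt_neqAle eq_sym I0.
  exact: le_trans q0 qI.
- exact: cvg_cst.
- by rewrite -[X in _ --> X]addr0; exact: cvgD.
Qed.

(** This is the equivalence for one test function, symmetric enough to serve both directions; the
    finiteness clauses allow the difference to be taken in the reals. *)
Lemma local_process_cond_integral_close (R : realType) (d : measure_display)
  (X : measurableType d) (mu : probability X R) (T : X -> X)
  (F : metricType R) (A A' : nat -> set X) (psi psi' : nat -> X -> F)
  (g : seqspace F -> R) (M : R) :
  measure_preserving mu T -> compact [set: F] ->
  (forall l, measurable (A l) /\ (0 < mu (A l))%E) ->
  (forall l, measurable (A' l) /\ (0 < mu (A' l))%E) ->
  (forall l, borel_measurable_on (A l) (psi l)) ->
  (forall l, borel_measurable_on (A' l) (psi' l)) ->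
  (fun l => fine (mu ((A l `\` A' l) `|` (A' l `\` A l))) / fine (mu (A l)))
            @ \oo --> 0 ->
  (forall e : R, 0 < e ->
     (fun l => fine (mu [set x | (A l `&` A' l) x /\ e < mdist (psi l x) (psi' l x)])
               / fine (mu (A l `&` A' l))) @ \oo --> 0) ->
  continuous g -> (forall z, `|g z| <= M) ->
  let Z l x := g (local_process T (A l) (psi l) x) in
  let Z' l x := g (local_process T (A' l) (psi' l) x) in
  [/\ forall l, cond_integral mu (A l) (Z l) \is a fin_num,
      forall l, cond_integral mu (A' l) (Z' l) \is a fin_num &
      (fun l => fine (cond_integral mu (A l) (Z l)) -
                fine (cond_integral mu (A' l) (Z' l))) @ \oo --> 0].
Proof.
move=> hT hF hA hA' hpsi hpsi' hsym hprob cg gM Z Z'.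
(* Positive mass of [A 0] supplies a point, and thereby an element of [F] to start the dense
   sequence and a sequence at which [g] is bounded by [M]. *)
have [x0 _] : exists x, A 0%N x.
  apply/set0P/eqP => A0; have [_] := hA 0%N.
  by rewrite A0 measure0 ltxx.
have [D denseD] := compact_dense_sequence hF (psi 0%N x0).
have M0 : 0 <= M by apply: le_trans (gM (fun=> psi 0%N x0)).
have mT := hT.1.
have mZ l : measurable_fun (A l) (Z l).
  apply: (measurable_fun_seqspace denseD) => //; first by case: (hA l).
  by move=> i; apply: borel_measurable_local_process => //; case: (hA l).
have mZ' l : measurable_fun (A' l) (Z' l).
  apply: (measurable_fun_seqspace denseD) => //; first by case: (hA' l).
  by move=> i; apply: borel_measurable_local_process => //; case: (hA' l).
split.
- by move=> l; exact: cond_integral_fin_num (hA l).1 (mZ l) (fun x => gM _).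
- by move=> l; exact: cond_integral_fin_num (hA' l).1 (mZ' l) (fun x => gM _).
apply/cvgrPdist_le => eps eps0.
have eps20 : 0 < eps / 2 by rewrite divr_gt0.
have [n gn] := continuous_seqspace_unif hF cg eps20.
(* Avoiding [Q l] yields only a weak inequality, so the threshold 1/(n+2) is taken strictly below
   the radius 1/(n+1) of cylinder [n]. *)
pose Q l := [set x | (A l `&` A' l) x /\
                     n.+2%:R^-1 < mdist (psi l x) (psi' l x)].
have mQ l : measurable (Q l).
  have mI : measurable (A l `&` A' l).
    by apply: measurableI; [case: (hA l)|case: (hA' l)].
  by apply: (measurable_mdist_gt denseD) => //;
    [apply: borel_measurable_on_subset (hpsi l)|
     apply: borel_measurable_on_subset (hpsi' l)].
pose E l := ((A l `\` A' l) `|` (A' l `\` A l)) `|` Q l.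
have E0 : (fun l => fine (mu (E l)) / fine (mu (A l))) @ \oo --> 0.
  apply: bad_set_negligible => //; first by move=> l; case: (hA' l).
    by move=> l x [].
  by apply: hprob.
(* The factor 2M comes from [cond_integral_close]; each of [A l] and [A' l] loses at most n+1 times
   the mass of [E l] outside the good set. *)
pose C : R := 2 * M * (2 * n.+1%:R).
have C0 : 0 <= C by rewrite /C !mulr_ge0.
have CE0 : (fun l => C * (fine (mu (E l)) / fine (mu (A l)))) @ \oo --> 0.
  by rewrite -[X in _ --> X](mulr0 C); apply: cvgM => //; exact: cvg_cst.
move/cvgrPdist_le : CE0 => /(_ _ eps20); apply: filterS => l.
rewrite !sub0r !normrN => CEl.
have [[mA A0] [mA' A'0]] := (hA l, hA' l).
have mE : measurable (E l).
  by apply: measurableU => //; apply: measurableU; exact: measurableD.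
pose B := A l `|` A' l.
have mB : measurable B by exact: measurableU.
have EB : E l `<=` B.
  by move=> x [[[? _]|[? _]]|[[? _] _]]; [left|right|left].
have mV : measurable (visits T B (E l) n.+1)
  by exact: (measurable_visits hT).
(* The times avoided are 0 to n. Time 0 is included even for n = 0, which places [G] inside both
   [A l] and [A' l]. *)
pose G := B `\` visits T B (E l) n.+1.
have mG : measurable G by exact: measurableD.
have good x i : G x -> (i <= n)%N ->
    [/\ A l (iter i (induced_map T B) x), A' l (iter i (induced_map T B) x) &
    mdist (psi l (iter i (induced_map T B) x))
          (psi' l (iter i (induced_map T B) x)) <= n.+2%:R^-1].
  move=> [Bx nV] ilen; set y := iter i _ x.
  have By : B y by exact: iter_induced_map_in.
  have nEy : ~ E l y by move=> Ey; apply: nV; split=> //; exists i.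
  have [Ay A'y] : A l y /\ A' l y.
    case: By => [Ay|A'y]; split=> //; apply: contrapT => ny; apply: nEy.
      by left; left.
    by left; right.
  split=> //; rewrite leNgt; apply/negP => h.
  by apply: nEy; right.
have GA : G `<=` A l by move=> x Gx; have [] := good x 0%N Gx (leq0n _).
have GA' : G `<=` A' l by move=> x Gx; have [] := good x 0%N Gx (leq0n _).
have close x : G x -> `|Z l x - Z' l x| <= eps / 2.
  move=> Gx; apply/ltW/gn => i ilen; rewrite /local_process.
  have goodi j : (j <= i)%N -> (j <= n)%N by move=> ji; exact: leq_trans ji (ltnW ilen).
  (* Both induced orbits are replaced by the orbit under [induced_map T B], so that [psi l] and
     [psi' l] are compared at the same point. *)
  rewrite (@iter_induced_map_eq _ _ T (A l) B); last 2 first.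
    by move=> y; left.
    by move=> j /goodi jn; have [] := good x j Gx jn.
  rewrite (@iter_induced_map_eq _ _ T (A' l) B); last 2 first.
    by move=> y; right.
    by move=> j /goodi jn; have [] := good x j Gx jn.
  have [_ _] := good x i Gx (ltnW ilen); move=> /le_lt_trans; apply.
  by rewrite ltf_pV2 ?posrE// ltr_nat.
apply: le_trans (cond_integral_close mA mA' mG GA GA' (mZ l) (mZ' l) M0
  (ltW eps20) (fun x => gM _) (fun x => gM _) close A0 A'0) _.
rewrite [leRHS]splitr lerD2l; apply: le_trans CEl; apply: le_trans (ler_norm _).
rewrite /C -[leRHS]mulrA ler_wpM2l ?mulr_ge0// mulrA ler_wpM2r ?invr_ge0 ?fine_ge0//.
have V_le := visits_measure_le hT n.+1 mB mE EB.
have subV (S : set X) : measurable S -> S `<=` B ->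
    fine (mu (S `\` G)) <= n.+1%:R * fine (mu (E l)).
  move=> mS SB; apply: le_trans V_le; apply: fine_measure_le => //.
    exact: measurableD.
  by move=> x [/SB Bx nG]; apply: contrapT => nV; apply: nG.
rewrite -mulrA [leRHS]mulr_natl mulr2n lerD// subV//.
  by move=> x; left.
by move=> x; right.
Qed.

Theorem mainTheorem7 (R : realType) (d : measure_display) (X : measurableType d)
  (mu : probability X R) (T : X -> X)
  (hT : measure_preserving mu T) (herg : ergodic mu T)
  (F : metricType R) (hF : compact [set: F])
  (A A' : nat -> set X) (psi psi' : nat -> X -> F)
  (hA : asymp_rare mu A) (hA' : asymp_rare mu A')
  (hpsi : forall l, borel_measurable_on (A l) (psi l))
  (hpsi' : forall l, borel_measurable_on (A' l) (psi' l))
  (hsym : (fun l => fine (mu ((A l `\` A' l) `|` (A' l `\` A l))) / fine (mu (A l)))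
            @ \oo --> 0)
  (hprob : forall e : R, 0 < e ->
     (fun l => fine (mu [set x | (A l `&` A' l) x /\ e < mdist (psi l x) (psi' l x)])
               / fine (mu (A l `&` A' l))) @ \oo --> 0) :
  forall (d' : measure_display) (Om : measurableType d') (P : probability Om R)
    (Psi : Om -> seqspace F),
    (forall U : set (seqspace F), open U -> measurable (Psi @^-1` U)) ->
    (weak_conv mu A (fun l => local_process T (A l) (psi l)) P Psi <->
     weak_conv mu A' (fun l => local_process T (A' l) (psi' l)) P Psi).
Proof.
move=> d' Om P Psi _.
(* Weak convergence lives in the extended reals, the comparison in the reals. Writing [u] as [v]
   plus the real difference bridges them, and the limit [c + 0] is defined for every [c] because 0
   is finite. *)
have transfer (u v : nat -> \bar R) (c : \bar R) :
    (forall l, u l \is a fin_num) -> (forall l, v l \is a fin_num) ->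
    (fun l => fine (u l) - fine (v l)) @ \oo --> 0 ->
    v @ \oo --> c -> u @ \oo --> c.
  move=> fu fv uv0 vc.
  rewrite (_ : u = fun l => (v l + (fine (u l) - fine (v l))%:E)%E); last first.
    by apply/funext => l; rewrite EFinB !fineK// addeCA subee// adde0.
  rewrite -[X in _ --> X]adde0; apply: cvgeD => //.
    by rewrite fin_num_adde_defl.
  by apply: cvg_EFin => //; exact: nearW.
split=> wc g cg [M gM];
  have [fin fin' cvg0] := local_process_cond_integral_close hT hF hA.1 hA'.1
    hpsi hpsi' hsym hprob cg gM.
- apply: transfer fin' fin _ (wc g cg (ex_intro _ M gM)).
  (* In this direction the two processes exchange roles, which reverses the sign of the
     difference. *)
  rewrite -oppr0; under eq_fun do rewrite -opprB.
  exact: cvgN.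
- exact: transfer fin fin' cvg0 (wc g cg (ex_intro _ M gM)).
Qed.
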